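(* Let $c\ge1$ and $a\ge0$ be integers and $b$ an indeterminate, and set $u_k=\binom{a+b}{a-k}$ for integers $k$. Then $$\det\left[u_{i-j}+u_{i+j+1}\right]_{i,j=0}^{c-1}=\prod_{i=1}^c\prod_{j=1}^a\frac{(b+i-j)(b+2i+j-1)}{(b+2i-j-1)(i+j-1)}.$$
   Context: For $z$ an indeterminate and $k$ an integer, $\binom{z}{k}=z(z-1)\cdots(z-k+1)/k!$ if $k\ge0$ and $\binom{z}{k}=0$ if $k<0$. The identity is an identity of rational functions in $b$. *)

(* Defs.v *)
From mathcomp Require Import all_boot all_order all_algebra.
Set Implicit Arguments.
Unset Strict Implicit.
Unset Printing Implicit Defensive.
Import GRing.Theory.
Local Open Scope ring_scope.

(* Division by n`! is meaningful only when F has characteristic 0. *)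
Definition gbinom (F : fieldType) (z : F) (k : int) : F :=
  match k with
  | Posz n => (\prod_(0 <= i < n) (z - i%:R)) / n`!%:R
  | Negz _ => 0
  end.

(* The field Q(b) of rational functions, with indeterminate b. *)
Definition ratfun : fieldType := {fraction {poly rat}}.

Definition b : ratfun := tofrac ('X : {poly rat}).

Definition u (a : nat) (k : int) : ratfun := gbinom (a%:R + b) (a%:Z - k).

(* Main.v *)
Require Import Defs.
From mathcomp Require Import all_boot all_order all_algebra.
From mathcomp Require Import ring zify.
Set Implicit Arguments.
Unset Strict Implicit.
Unset Printing Implicit Defensive.
Import GRing.Theory.
Local Open Scope ring_scope.

(** Column operations: [u_(i-j) + u_(i+j+1)] is the coefficient of [x^(a-i)] in
    [(x^(-j) + x^(j+1)) (1+x)^(a+b)], and up to a unitriangular change of basis the Laurent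
    polynomials [x^(-j) + x^(j+1)] may be replaced by [(1+x)^(2j+1) x^(-j)].  The determinant is
    therefore that of [binom (a+b+2j+1) (a-i+j)].  After a factor depending only on [j] is taken out
    of column [j], row [i] is the polynomial
    [prod_(k<i) (X + a - k) * prod_(i<k<c) (X + b + 1 + k)] evaluated at [X = j], and this
    determinant is a product: the differences of consecutive rows are multiples of polynomials of
    the same shape and lower degree, so the coefficient matrix reduces by induction, and the
    remaining factor is a Vandermonde determinant. *)

(** * Determinants of mixed products of linear factors *)

Section ProductDeterminant.

Variable R : idomainType.
Implicit Types (A B x : nat -> R) (n i : nat).

Definition mixed_poly A B n i : {poly R} :=
  \prod_(0 <= k < i) ('X + (B k)%:P) * \prod_(i.+1 <= k < n) ('X + (A k)%:P).

Lemma prod_XaddC_monic_size (f : nat -> R) m n :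
  (\prod_(m <= k < n) ('X + (f k)%:P) \is monic) /\
  size (\prod_(m <= k < n) ('X + (f k)%:P)) = (n - m).+1.
Proof.
have E : \prod_(m <= k < n) ('X + (f k)%:P) =
   \prod_(z <- [seq - f k | k <- index_iota m n]) ('X - z%:P).
  by rewrite big_map; apply: eq_bigr => k _; rewrite polyCN opprK.
by rewrite E monic_prod_XsubC size_prod_XsubC size_map size_iota.
Qed.

Lemma size_mixed_poly A B n i : (i < n)%N -> size (mixed_poly A B n i) = n.
Proof.
move=> lt_in; rewrite /mixed_poly.
have [m1 s1] := prod_XaddC_monic_size B 0 i.
have [m2 s2] := prod_XaddC_monic_size A i.+1 n.
by rewrite size_monicM ?monic_neq0 // s1 s2; lia.
Qed.

Lemma mixed_poly_lead A B n : (mixed_poly A B n.+1 n)`_n = 1.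
Proof.
rewrite /mixed_poly [X in _ * X]big_geq // mulr1.
have [/monicP + s1] := prod_XaddC_monic_size B 0 n.
by rewrite lead_coefE s1 subn0.
Qed.

(** The two products differ in a single factor, ['X + A i.+1] against ['X + B i]; shifting [A]
    reindexes the common factors. *)
Lemma mixed_poly_step A B n i : (i < n)%N ->
  mixed_poly A B n.+1 i - mixed_poly A B n.+1 i.+1 =
  (A i.+1 - B i) *: mixed_poly (fun k => A k.+1) B n i.
Proof.
move=> lt_in; rewrite /mixed_poly [\prod_(i.+1 <= k < n.+1) _]big_ltn //.
rewrite [\prod_(0 <= k < i.+1) _]big_nat_recr //=.
rewrite [\prod_(i.+2 <= k < n.+1) _]big_add1 /=.
by rewrite -mul_polyC polyCB; ring.
Qed.

Lemma det_mixed_poly_coef A B n :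
  \det (\matrix_(i < n, j < n) (mixed_poly A B n i)`_j) =
  \prod_(0 <= k < n) \prod_(0 <= i < k) (A k - B i).
Proof.
elim: n A => [|n IHn] A; first by rewrite det_mx00 big_geq.
(* Left multiplication by [U] subtracts from each row the next one; the last row is kept, since
   [j == i.+1] never holds there. *)
pose U := \matrix_(i < n.+1, j < n.+1) ((i == j)%:R - (j == i.+1 :> nat)%:R : R).
set C := \matrix_(i, j) _.
have detU : \det U = 1.
  rewrite -det_tr det_trig; last first.
    apply/is_trig_mxP => i j lt_ij; rewrite !mxE.
    have -> : (j == i) = false by apply/negbTE; rewrite neq_ltn lt_ij orbT.
    by rewrite (_ : _ == _ = false) ?subr0 //; lia.
  by apply: big1 => i _; rewrite !mxE eqxx (_ : _ == _ = false) ?subr0 //; lia.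
pose D := \row_(i < n) (A i.+1 - B i).
have UC (i j : 'I_n.+1) : (U *m C) i j =
    if (i < n)%N then (A i.+1 - B i) * (mixed_poly (fun k => A k.+1) B n i)`_j
    else (mixed_poly A B n.+1 n)`_j.
  rewrite mxE; under eq_bigr do rewrite !mxE mulrBl.
  rewrite sumrB (bigD1 i) //= eqxx mul1r big1 ?addr0; last first.
    by move=> k /negbTE nki; rewrite eq_sym nki mul0r.
  case: ifP => lt_in.
    rewrite (bigD1 (inord i.+1)) //= inordK ?ltnS // eqxx mul1r big1 ?addr0.
      by rewrite -coefB mixed_poly_step // coefZ.
    move=> k nk; rewrite (_ : _ == _ = false) ?mul0r //.
    by apply: contraNF nk => /eqP e; apply/eqP/val_inj; rewrite /= inordK -?e.
  have ein : i = n :> nat by have := ltn_ord i; lia.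
  rewrite ein big1 ?subr0 // => k _.
  by rewrite (_ : _ == _ = false) ?mul0r //; have := ltn_ord k; lia.
have -> : \det C = \det (U *m C) by rewrite det_mulmx detU mul1r.
(* The rows above the last now have degree below [n], so the last column is zero except for the
   leading coefficient 1 in the corner. *)
rewrite (expand_det_col _ ord_max) (bigD1 ord_max) //= UC ltnn mixed_poly_lead mul1r.
rewrite big1 ?addr0; last first.
  move=> i ni; have lt_in : (i < n)%N.
    by have := ltn_ord i; rewrite ltnS leq_eqVlt => /orP[/eqP e|//]; case/eqP: ni; apply/val_inj.
  by rewrite UC lt_in nth_default ?mulr0 ?mul0r // size_mixed_poly.
rewrite /cofactor -signr_odd addnn odd_double expr0 mul1r.
have -> : row' ord_max (col' ord_max (U *m C)) =
   diag_mx D *m \matrix_(i < n, j < n) (mixed_poly (fun k => A k.+1) B n i)`_j.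
  apply/matrixP => i j; rewrite mul_diag_mx [LHS]mxE [LHS]mxE UC !lift_max ltn_ord.
  by rewrite !mxE.
(* The entries of [D] supply the factors [A k.+1 - B k] that the induction hypothesis for the
   shifted [A] lacks. *)
rewrite det_mulmx det_diag IHn big_nat_recl // [X in _ = X * _]big_geq // mul1r.
under eq_bigr do rewrite mxE.
rewrite -(big_mkord xpredT (fun i => A i.+1 - B i)) -big_split /=.
by apply: eq_bigr => k _; rewrite big_nat_recr //= mulrC.
Qed.

(* A determinant evaluation due to Krattenthaler. *)
Lemma det_mixed_poly A B x n :
  \det (\matrix_(i < n, j < n) (mixed_poly A B n i).[x j]) =
  \prod_(0 <= k < n) \prod_(0 <= i < k) ((A k - B i) * (x k - x i)).
Proof.
have -> : \matrix_(i < n, j < n) (mixed_poly A B n i).[x j] =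
   (\matrix_(i < n, j < n) (mixed_poly A B n i)`_j) *m Vandermonde n (\row_j x j).
  apply/matrixP => i j; rewrite !mxE (@horner_coef_wide _ n) ?size_mixed_poly //.
  by apply: eq_bigr => k _; rewrite !mxE.
rewrite det_mulmx det_mixed_poly_coef det_Vandermonde.
under [RHS]eq_bigr do rewrite big_split.
rewrite [RHS]big_split; congr (_ * _).
rewrite (exchange_big_dep xpredT) //= big_mkord; apply: eq_bigr => k _.
rewrite big_mkord (big_ord_widen _ (fun i => x k - x i) (ltnW (ltn_ord k))).
by apply: eq_bigr => i _; rewrite !mxE.
Qed.

End ProductDeterminant.

(** * Binomial coefficients and the column operations *)

Section Binomials.

Variable F : fieldType.
Hypothesis natF_neq0 : forall n, n.+1%:R != 0 :> F.
Implicit Types (x y z : F) (m n : nat) (K : int).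

Lemma factF_neq0 n : n`!%:R != 0 :> F.
Proof. by have := fact_gt0 n; case: (n`!) => // m _; apply: natF_neq0. Qed.

Definition rising x n : F := \prod_(0 <= k < n) (x + k%:R).

Lemma risingD x m n : rising x (m + n) = rising x m * rising (x + m%:R) n.
Proof.
elim: n => [|n IHn]; rewrite /rising.
  by rewrite addn0 [X in _ = _ * X]big_geq ?mulr1.
by rewrite addnS !big_nat_recr //= -!/(rising _ _) IHn natrD mulrA addrA.
Qed.

Lemma prod_falling x n : \prod_(0 <= k < n) (x - k%:R) = rising (x - n%:R + 1) n.
Proof.
rewrite big_nat_rev /rising; apply: eq_big_nat => k /= lt_kn.
by rewrite (_ : (0 + n - k.+1) = n - k.+1)%N // natrB // -natr1; ring.
Qed.

Lemma rising_nat m n : rising m.+1%:R n * m`!%:R = (m + n)`!%:R.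
Proof.
elim: n => [|n IHn]; first by rewrite /rising big_geq // mul1r addn0.
by rewrite /rising big_nat_recr //= -/(rising _ _) mulrAC IHn addnS factS natrM -natrD addSn mulrC.
Qed.

Lemma gbinom_nat z n : gbinom z n%:Z = rising (z - n%:R + 1) n / n`!%:R.
Proof. by rewrite /gbinom prod_falling. Qed.

Lemma gbinom_pascal z K : gbinom (z + 1) K = gbinom z K + gbinom z (K - 1).
Proof.
case: K => [[|n]|n].
- by rewrite /gbinom /= !big_geq // addr0.
- have -> : n.+1%:Z - 1 = n%:Z by lia.
  rewrite /gbinom big_nat_recl // big_nat_recr //=.
  have -> : \prod_(0 <= i < n) (z + 1 - i.+1%:R) = \prod_(0 <= i < n) (z - i%:R).
    by apply: eq_bigr => i _; rewrite -natr1; ring.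
  rewrite factS natrM; field.
  by rewrite factF_neq0 addrC natr1 natF_neq0.
- by rewrite (_ : Negz n - 1 = Negz n.+1) /= ?addr0 //; lia.
Qed.

(** Induction on [n], with Pascal's rule for [gbinom] on the left and for ['C(n.+1, k)] on the
    right. *)
Lemma gbinom_vandermonde n z K :
  gbinom (z + n%:R) K = \sum_(0 <= k < n.+1) 'C(n, k)%:R * gbinom z (K - k%:Z).
Proof.
elim: n K => [|n IHn] K.
  by rewrite big_nat1 bin0 mul1r subr0 addr0.
rewrite -natr1 addrA gbinom_pascal !IHn [RHS]big_nat_recl //= bin0.
under [X in _ = _ + X]eq_bigr do rewrite binS natrD mulrDl.
rewrite big_split /= addrA; congr (_ + _).
  rewrite big_nat_recl // big_nat_recr //= bin0 bin_small //.
  by rewrite mul0r !addr0.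
apply: eq_bigr => k _; congr (_ * gbinom z _); lia.
Qed.

(** Pairs the indices symmetric about j + 1/2, at which the binomial coefficients of 2j+1 agree. *)
Lemma sum_fold_middle (V : nmodType) (f : nat -> V) j :
  \sum_(0 <= k < (2 * j + 1).+1) f k =
  \sum_(0 <= m < j.+1) (f (j - m)%N + f (j + 1 + m)%N).
Proof.
rewrite (@big_cat_nat _ _ _ j.+1) //=; last by lia.
rewrite big_split /=; congr (_ + _).
  by rewrite big_nat_rev; apply: eq_big_nat => k lt_kj; congr f; lia.
rewrite -{1}[j.+1]add0n big_addn (_ : ((2 * j + 1).+1 - j.+1 = j.+1)%N); last by lia.
by apply: eq_bigr => k _; congr f; lia.
Qed.

(* [(1+x)^(2j+1) x^(-j)] is the combination of the [x^(-m) + x^(m+1)], [m <= j], with coefficients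
   [binom (2j+1) (j-m)]; these form a unitriangular column transformation. *)
Lemma det_fold_binom c z L :
  \det (\matrix_(i < c, j < c)
    (gbinom z (L - (i%:Z - j%:Z)) + gbinom z (L - (i%:Z + j%:Z + 1)))) =
  \det (\matrix_(i < c, j < c) gbinom (z + (2 * j + 1)%N%:R) (L - i%:Z + j%:Z)).
Proof.
set M := \matrix_(i, j) _; set N := (X in _ = \det X).
pose T := \matrix_(m < c, j < c) (if (m <= j)%N then 'C(2 * j + 1, j - m)%:R else 0 : F).
have detT : \det T = 1.
  rewrite -det_tr det_trig; last first.
    by apply/is_trig_mxP => i j lt_ij; rewrite !mxE leqNgt lt_ij.
  by apply: big1 => i _; rewrite !mxE leqnn subnn bin0.
suff -> : N = M *m T by rewrite det_mulmx detT mulr1.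
apply/matrixP => i j; rewrite !mxE gbinom_vandermonde sum_fold_middle.
have widen (f : nat -> F) :
    \sum_(0 <= m < j.+1) f m = \sum_(m < c) if (m <= j)%N then f m else 0.
  by rewrite big_mkord (big_ord_widen c f (ltn_ord j)) big_mkcond.
rewrite widen.
apply: eq_bigr => m _; rewrite !mxE; case: ifP => le_mj; last by rewrite mulr0.
have -> : 'C(2 * j + 1, j + 1 + m) = 'C(2 * j + 1, j - m).
  by rewrite -bin_sub; [congr 'C(_, _)|]; lia.
(* For k = j - m and k = j + 1 + m, the lower index L - i + j - k is L - (i - m) and L - (i + m +
   1). *)
rewrite -mulrDr mulrC; congr ((gbinom z _ + gbinom z _) * _); lia.
Qed.

(** * Column factors and comparison with the product *)

Variable b : F.
Hypothesis b_generic : forall k : int, b + k%:~R != 0.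

Lemma rising_neq0 x n : (exists k : int, x = b + k%:~R) -> rising x n != 0.
Proof.
move=> [k ->]; rewrite prodf_seq_neq0; apply/allP => m _ /=.
by rewrite -addrA pmulrn -intrD.
Qed.

(** With x = b + j + 2, the binomial has 1 / [rising x i] as a factor; dividing by [rising x c.-1]
    instead leaves the polynomial factors with i < k < c in the entry. *)
Definition colfactor a c j : F :=
  rising (b + j%:R + 2%:R) (a + j) / (a + j)`!%:R / rising (b + j%:R + 2%:R) c.-1.

Lemma gbinom_factor a c i j : (i < c)%N ->
  gbinom (a%:R + b + (2 * j + 1)%N%:R) (a%:Z - i%:Z + j%:Z) =
  colfactor a c j *
  (mixed_poly (fun k => b + 1 + k%:R) (fun k => a%:R - k%:R) c i).[j%:R].
Proof.
move=> lt_ic; rewrite /mixed_poly hornerM !horner_prod.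
under eq_bigr do rewrite hornerD hornerX hornerC addrA -natrD (addnC j).
under [X in _ = _ * (_ * X)]eq_bigr do rewrite hornerD hornerX hornerC.
case: (leqP i (a + j)) => [le_i|lt_i]; last first.
  (* The lower index is negative, so the binomial is 0; on the right the factor k = a + j vanishes
     at X = j. *)
  have -> : a%:Z - i%:Z + j%:Z = Negz (i - (a + j)).-1 by lia.
  rewrite /= (bigD1_seq (a + j)%N) ?iota_uniq ?mem_index_iota //=.
  by rewrite subrr !mul0r mulr0.
pose n := (a + j - i)%N; have aj : (a + j = i + n)%N by rewrite /n; lia.
have ajF : a%:R + j%:R = i%:R + n%:R :> F by rewrite -!natrD aj.
have -> : a%:Z - i%:Z + j%:Z = n%:Z by rewrite /n; lia.
rewrite gbinom_nat.
rewrite prod_falling.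
have -> : (a + j)%:R - i%:R + 1 = n.+1%:R :> F by rewrite natrD ajF -natr1; ring.
pose x := b + j%:R + 2%:R.
have -> : a%:R + b + (2 * j + 1)%:R - n%:R + 1 = x + i%:R.
  have -> : a%:R = i%:R + n%:R - j%:R :> F by rewrite -ajF; ring.
  by rewrite /x natrD natrM; ring.
have -> : \prod_(i.+1 <= k < c) (j%:R + (b + 1 + k%:R)) = rising (x + i%:R) (c.-1 - i).
  rewrite -{1}[i.+1]add0n big_addn (_ : (c - i.+1 = c.-1 - i)%N); last by lia.
  by apply: eq_bigr => k _; rewrite /x natrD -natr1; ring.
rewrite /colfactor -/x (_ : c.-1 = i + (c.-1 - i))%N; last by lia.
rewrite addKn aj !risingD [(i + n)%N]addnC -rising_nat.
have xi k : rising (x + k%:R) (c.-1 - i) != 0.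
  apply: rising_neq0; exists (j + 2 + k)%N%:Z.
  by rewrite -pmulrn !natrD /x; ring.
have x0 : rising x i != 0.
  by apply: rising_neq0; exists (j + 2)%N%:Z; rewrite -pmulrn natrD addrA.
have r0 : rising n.+1%:R i != 0.
  by apply: contra_neq (factF_neq0 (n + i)) => e; rewrite -rising_nat e mul0r.
by field; rewrite x0 xi r0 factF_neq0.
Qed.

(** Each old column factor is divided by one new factor b + j + c + 1, and these multiply to
    [rising (b + c%:R + 1) c]; the rest is the new column j = c. *)
Lemma prod_colfactorS a c :
  \prod_(0 <= j < c.+1) colfactor a c.+1 j =
  (\prod_(0 <= j < c) colfactor a c j) *
  (rising (b + c%:R + 2%:R) (a + c) / (a + c)`!%:R
     / (rising (b + c%:R + 1) c * rising (b + c%:R + 2%:R) c)).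
Proof.
rewrite big_nat_recr //= {2}/colfactor.
have -> : \prod_(0 <= j < c) colfactor a c.+1 j =
    \prod_(0 <= j < c) colfactor a c j / rising (b + c%:R + 1) c.
  rewrite /rising -prodfV -big_split; apply: eq_big_nat => j lt_jc /=.
  case: c lt_jc => [|d] // _; rewrite /colfactor /=.
  rewrite [rising _ d.+1]big_nat_recr //= -/(rising _ _) invfM mulrA.
  by congr (_ / _); rewrite -natr1; ring.
by rewrite invfM; ring.
Qed.

Definition box_term i j : F :=
  ((b + i%:R - j%:R) * (b + 2%:R * i%:R + j%:R - 1)) /
  ((b + 2%:R * i%:R - j%:R - 1) * (i%:R + j%:R - 1)).

Lemma prod_box_term a c :
  \prod_(1 <= j < a.+1) box_term c.+1 j =
  rising (b + c%:R + 1 - a%:R) a * rising (b + c%:R + 2%:R + c%:R) a /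
  (rising (b + c%:R + 1 - a%:R + c%:R) a * rising c.+1%:R a).
Proof.
rewrite big_add1 /= !big_split /= prodfV big_split /=.
congr (_ * _ / (_ * _)).
- have -> : b + c%:R + 1 - a%:R = b + c%:R - a%:R + 1 by ring.
  by rewrite -prod_falling; apply: eq_bigr => j _; rewrite -!natr1; ring.
- by apply: eq_bigr => j _; rewrite -!natr1; ring.
- have -> : b + c%:R + 1 - a%:R + c%:R = b + c%:R + c%:R - a%:R + 1 by ring.
  by rewrite -prod_falling; apply: eq_bigr => j _; rewrite -!natr1; ring.
- by apply: eq_bigr => j _; rewrite -!natr1; ring.
Qed.

(** Induction on [c]: the factors contributed by column c and by k = c must match the box terms with
    i = c + 1. *)
Lemma prod_colfactor_box a c :
  (\prod_(0 <= j < c) colfactor a c j) *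
  (\prod_(0 <= k < c) \prod_(0 <= i < k)
     ((b + 1 + k%:R - (a%:R - i%:R)) * (k%:R - i%:R))) =
  \prod_(1 <= i < c.+1) \prod_(1 <= j < a.+1) box_term i j.
Proof.
elim: c => [|c IHc]; first by rewrite !big_geq // mulr1.
rewrite prod_colfactorS [in RHS]big_nat_recr //= -IHc prod_box_term.
rewrite [\prod_(0 <= k < c.+1) _]big_nat_recr //=.
have -> : \prod_(0 <= i < c) ((b + 1 + c%:R - (a%:R - i%:R)) * (c%:R - i%:R)) =
    rising (b + c%:R + 1 - a%:R) c * c`!%:R.
  rewrite big_split /= prod_falling subrr add0r; congr (_ * _).
    by apply: eq_bigr => i _; ring.
  by have := rising_nat 0 c; rewrite mulr1.
have e1 : rising (b + c%:R + 2%:R) (a + c) =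
    rising (b + c%:R + 2%:R) c * rising (b + c%:R + 2%:R + c%:R) a.
  by rewrite addnC risingD.
(* Both sides are the rising factorial of length a + c from b + c + 1 - a, split after a factors and
   after c factors. *)
have e2 : rising (b + c%:R + 1 - a%:R) a * rising (b + c%:R + 1) c =
    rising (b + c%:R + 1 - a%:R) c * rising (b + c%:R + 1 - a%:R + c%:R) a.
  rewrite -risingD addnC risingD; congr (_ * rising _ _); ring.
have n1 : rising (b + c%:R + 1) c != 0.
  by apply: rising_neq0; exists (c + 1)%N%:Z; rewrite -pmulrn natrD addrA.
have n2 : rising (b + c%:R + 2%:R) c != 0.
  by apply: rising_neq0; exists (c + 2)%N%:Z; rewrite -pmulrn natrD; ring.
have n3 : rising (b + c%:R + 1 - a%:R + c%:R) a != 0.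
  apply: rising_neq0; exists ((c + 1 + c)%N%:Z - a%:Z).
  by rewrite intrB -!pmulrn !natrD; ring.
have n4 : rising c.+1%:R a != 0.
  by apply: contra_neq (factF_neq0 (c + a)) => e; rewrite -rising_nat e mul0r.
have -> : rising (b + c%:R + 1 - a%:R) a =
    rising (b + c%:R + 1 - a%:R) c * rising (b + c%:R + 1 - a%:R + c%:R) a
      / rising (b + c%:R + 1) c.
  by rewrite -e2 mulfK.
rewrite e1 [(a + c)%N]addnC -rising_nat.
by field; rewrite n1 n2 n3 n4 factF_neq0.
Qed.

Lemma det_folded_gbinom a c :
  \det (\matrix_(i < c, j < c)
    (gbinom (a%:R + b) (a%:Z - (i%:Z - j%:Z)) +
     gbinom (a%:R + b) (a%:Z - (i%:Z + j%:Z + 1)))) =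
  \prod_(1 <= i < c.+1) \prod_(1 <= j < a.+1) box_term i j.
Proof.
rewrite det_fold_binom.
pose P := \matrix_(i < c, j < c)
  (mixed_poly (fun k => b + 1 + k%:R) (fun k => a%:R - k%:R) c i).[j%:R].
have -> : \matrix_(i < c, j < c) gbinom (a%:R + b + (2 * j + 1)%:R) (a%:Z - i%:Z + j%:Z) =
    P *m diag_mx (\row_j colfactor a c j).
  by apply/matrixP => i j; rewrite mul_mx_diag !mxE (gbinom_factor _ _ (ltn_ord i)) mulrC.
rewrite det_mulmx det_diag (det_mixed_poly _ _ (fun j => j%:R)) -prod_colfactor_box.
rewrite mulrC; under eq_bigr do rewrite mxE.
by rewrite -(big_mkord xpredT (colfactor a c)).
Qed.

End Binomials.

(** * Specialisation to the field of rational functions *)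

Lemma ratfun_natr_neq0 n : n.+1%:R != 0 :> ratfun.
Proof.
rewrite -(rmorph_nat (@tofrac {poly rat})) tofrac_eq0 -polyC_natr polyC_eq0.
by rewrite Num.Theory.pnatr_eq0.
Qed.

Lemma ratfun_b_generic (k : int) : b + k%:~R != 0.
Proof.
rewrite /b -(rmorph_int (@tofrac {poly rat})) -rmorphD tofrac_eq0.
by rewrite -size_poly_eq0 -(rmorph_int (@polyC rat)) size_XaddC.
Qed.

Theorem theorem3 (c a : nat) (hc : (1 <= c)%N) :
  \det (\matrix_(i < c, j < c)
          (u a (i%:Z - j%:Z) + u a (i%:Z + j%:Z + 1))) =
  \prod_(1 <= i < c.+1) \prod_(1 <= j < a.+1)
    (((b + i%:R - j%:R) * (b + 2%:R * i%:R + j%:R - 1)) /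
     ((b + 2%:R * i%:R - j%:R - 1) * (i%:R + j%:R - 1))).
Proof. exact: (det_folded_gbinom ratfun_natr_neq0 ratfun_b_generic a c). Qed.
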